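(* If $\alpha>0$, $1<\beta<3/2$ and $\tanh\big(\frac{\pi\alpha}{3}\big)\tan\big(\frac{\pi\beta}{3}\big)=\sqrt{3}$, then \[ \prod_{n=1}^\infty\left(\frac{(n^2+\alpha^2)(n^2-\beta^2)}{n^2(n^2-9/4)}\right)^{n\left(\frac{n}{3}\right)}=e^{-2\pi\alpha\beta/3}. \]
   Context: $\left(\frac{n}{3}\right)$ is the Legendre symbol modulo $3$: it equals $1$ if $n\equiv1$, $-1$ if $n\equiv 2$, and $0$ if $n\equiv 0\pmod 3$. In the product, $n\left(\frac n3\right)$ is the exponent. The infinite product is the limit of the partial products $\prod_{n=1}^N$ as $N\to\infty$. *)

(* Defs.v *)
From Stdlib Require Import Reals ZArith List.
From Coquelicot Require Import Coquelicot.
Open Scope R_scope.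

Definition legendre3 (n : nat) : Z :=
  match Nat.modulo n 3 with
  | 1%nat => 1%Z
  | 2%nat => (-1)%Z
  | _ => 0%Z
  end.

(* The product runs over n = 1, ..., N. *)
Definition partial_prod (a : nat -> R) (N : nat) : R :=
  fold_right Rmult 1 (map a (seq 1 N)).

Definition is_infinite_prod (a : nat -> R) (l : R) : Prop :=
  is_lim_seq (partial_prod a) l.

(* Main.v *)
Require Import Defs.
From Stdlib Require Import Reals ZArith List Lra Lia.
From Coquelicot Require Import Coquelicot.
Open Scope R_scope.

(** The two parameters are tied by a relation that describes a curve, which
    solves to [beta = curve alpha] with
    [curve t = 3/2 - (3/PI) atan (tanh (PI t / 3) / sqrt 3)].  It starts at
    [t = 0], [curve 0 = 3/2], where every factor of the product equals 1 and
    [t * curve t = 0].  So it is enough to show that, along the curve, the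
    logarithm of the product and [- (2 PI / 3) t * curve t] have the same
    derivative.

    Differentiating the partial products produces the sums
    [S_N(s) = sum_(n <= N) chi(n) n / (n^2 - s)] at [s = - t^2] and at
    [s = (curve t)^2].  Their limit is a partial fraction expansion: with
    [C(v) = cosh (t v)] or [C(v) = cos (curve t * v)], that is, the solution of
    [C'' = - s C], [C(0) = 1], [C'(0) = 0],
    [S_N(s) --> (PI sqrt 3 / 6) / (1/2 + C(2 PI / 3))].
    The two quantities [1/2 + C(2 PI / 3)] met on the curve have product [-3/4],
    and the speed of the curve is [- (sqrt 3 / 2)] divided by the hyperbolic one.
    With these two facts the limits of the derivatives cancel exactly.

    The expansion ([chi_resolvent_lim]) is obtained in the manner of
    Dirichlet.  On [[0, L]] with [L = 2 PI / 3], two integrations by parts give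
    [(1/2 + C(L)) n / (n^2 - s) = int_0^L sin (n (L - v)) C(v) dv] for every [n]
    prime to 3.  Hence [(1/2 + C(L)) S_N(s)] is the integral of [C] against the
    kernel [sum chi(n) sin (n (L - v))], which for [N = 3 K] is
    [sin (3 K v) / (1 + 2 cos (L - v))], a quotient whose denominator vanishes
    on [[0, L]] only at [v = 0].  Subtracting
    the same integral with [cos v] in the place of [C(v)], which orthogonality
    evaluates to [PI sqrt 3 / 6], replaces [C(v)] by [C(v) - cos v], which
    compensates that zero: the integrand is [sin (3 K v)] times a continuous
    function, and the Riemann-Lebesgue lemma ([riemann_lebesgue_periods]) finishes.

    The limit is uniform on bounded arcs of the curve, because the partial sums of
    [chi] are 0 or 1: as in Leibniz's test, the error at rank [N] is at most
    the next term of [n / (n^2 - s)] ([chi_resolvent_error]).  The mean value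
    theorem then bounds the logarithmic defect of the [N]-th partial product by
    a constant over [N + 1] ([log_partial_prod_bound]). *)

(** * Two facts of real analysis *)

(** A Riemann-Lebesgue lemma along the frequencies whose period divides [L].
    Over one period the sine integrates to 0, so [g] may be replaced by its
    difference with its value at the left end, and uniform continuity of [g]
    makes this small. *)
Lemma riemann_lebesgue_periods (g : R -> R) (L : R) :
  0 < L ->
  (forall x, 0 <= x <= L -> continuity_pt g x) ->
  is_lim_seq (fun K => RInt (fun v => sin (2 * PI * INR K / L * v) * g v) 0 L) 0.
Proof.
intros HL Hg.
assert (Hint : forall w a b, 0 <= a <= b -> b <= L ->
  ex_RInt (fun v => sin (w * v) * g v) a b).
{ intros w a b Hab HbL. apply (ex_RInt_continuous (V := R_CompleteNormedModule)).
  intros z Hz. rewrite Rmin_left, Rmax_right in Hz by lra.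
  apply (continuous_mult (K := R_AbsRing) (fun v => sin (w * v)) g).
  - apply (ex_derive_continuous (fun v => sin (w * v))). auto_derive. exact I.
  - apply continuity_pt_filterlim. apply Hg. lra. }
apply is_lim_seq_spec. intros eps.
assert (He : 0 < eps / (2 * L)) by (apply Rdiv_lt_0_compat; [apply eps | lra]).
destruct (Heine_cor2 (f := g) (a := 0) (b := L) Hg (mkposreal _ He)) as [del Hdel].
simpl in Hdel.
assert (HdL : 0 < del / L) by (apply Rdiv_lt_0_compat; [apply del | lra]).
destruct (archimed_cor1 _ HdL) as [N [HN HN0]].
exists N. intros K HK.
assert (HK0 : 0 < INR K) by (apply lt_0_INR; lia).
assert (HNK : INR N <= INR K) by (apply le_INR; lia).
assert (HN0' : 0 < INR N) by (apply lt_0_INR; lia).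
set (w := 2 * PI * INR K / L). set (h := L / INR K).
assert (Hw : 0 < w).
{ unfold w. apply Rdiv_lt_0_compat; [|lra]. pose proof PI_RGT_0. nra. }
assert (Hh : 0 < h) by (apply Rdiv_lt_0_compat; lra).
assert (Hhdel : h < del).
{ unfold h. apply Rle_lt_trans with (L * / INR N).
  - apply Rmult_le_compat_l; [lra|]. apply Rinv_le_contravar; lra.
  - replace (pos del) with (L * (del / L)) by (field; lra).
    apply Rmult_lt_compat_l; lra. }
assert (HKh : INR K * h = L) by (unfold h; field; lra).
assert (Hwh : w * h = 2 * PI) by (unfold w, h; field; lra).
(* The estimate is accumulated one period [h] at a time. *)
assert (Hj : forall j, (j <= K)%nat ->
  Rabs (RInt (fun v => sin (w * v) * g v) 0 (INR j * h)) <= INR j * h * (eps / (2 * L))).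
{ induction j as [|j IH]; intros HjK.
  - simpl INR. rewrite Rmult_0_l, RInt_point. unfold zero; simpl. rewrite Rabs_R0. lra.
  - specialize (IH ltac:(lia)).
    assert (Hj0 : 0 <= INR j) by apply pos_INR.
    assert (HSj : INR (S j) <= INR K) by (apply le_INR; lia).
    rewrite S_INR in HSj. rewrite S_INR.
    set (a := INR j * h) in *. set (b := (INR j + 1) * h).
    assert (Ha : 0 <= a) by (unfold a; nra).
    assert (Hab : b = a + h) by (unfold a, b; ring).
    assert (HbL : b <= L) by (unfold b; nra).
    rewrite <- (RInt_Chasles _ 0 a b) by (apply Hint; lra).
    assert (Hsin : is_RInt (fun v => sin (w * v) * g a) a b 0).
    { replace 0 with (minus (- (cos (w * b) / w) * g a) (- (cos (w * a) / w) * g a)).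
      - apply (is_RInt_derive (fun v => - (cos (w * v) / w) * g a)).
        + intros x _. auto_derive; [exact I|]. field. lra.
        + intros x _. apply (ex_derive_continuous (fun v => sin (w * v) * g a)).
          auto_derive. exact I.
      - replace (w * b) with (0 + 2 * INR (S j) * PI)
          by (rewrite S_INR; unfold b; transitivity ((INR j + 1) * (w * h)); [rewrite Hwh|]; ring).
        replace (w * a) with (0 + 2 * INR j * PI)
          by (unfold a; transitivity (INR j * (w * h)); [rewrite Hwh|]; ring).
        rewrite !cos_period. unfold minus, plus, opp; simpl. ring. }
    assert (Hdiff : RInt (fun v => sin (w * v) * g v) a b
                    = RInt (fun v => sin (w * v) * (g v - g a)) a b).
    { symmetry. apply is_RInt_unique.
      replace (RInt (fun v => sin (w * v) * g v) a b)
        with (minus (RInt (fun v => sin (w * v) * g v) a b) 0)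
        by (unfold minus, plus, opp; simpl; ring).
      apply (is_RInt_ext (fun v => minus (sin (w * v) * g v) (sin (w * v) * g a))).
      - intros x _. unfold minus, plus, opp; simpl. ring.
      - apply (is_RInt_minus (V := R_NormedModule)); [|exact Hsin].
        apply (RInt_correct (V := R_CompleteNormedModule)). apply Hint; lra. }
    rewrite Hdiff. unfold plus; simpl.
    eapply Rle_trans; [apply Rabs_triang|].
    replace (b * (eps / (2 * L))) with (a * (eps / (2 * L)) + (b - a) * (eps / (2 * L))) by ring.
    apply Rplus_le_compat; [exact IH|].
    apply abs_RInt_le_const; [lra| |].
    + apply (ex_RInt_ext (fun v => minus (sin (w * v) * g v) (sin (w * v) * g a))).
      * intros x _. unfold minus, plus, opp; simpl. ring.
      * apply (ex_RInt_minus (V := R_NormedModule)); [apply Hint; lra|].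
        exists 0. exact Hsin.
    + intros t Ht. rewrite Rabs_mult.
      assert (Rabs (sin (w * t)) <= 1) by (apply Rabs_le; apply SIN_bound).
      assert (Rabs (g t - g a) < eps / (2 * L)).
      { apply Hdel; try lra. apply Rabs_def1; lra. }
      pose proof (Rabs_pos (g t - g a)). pose proof (Rabs_pos (sin (w * t))). nra. }
specialize (Hj K (Nat.le_refl K)). rewrite HKh in Hj. fold w. rewrite Rminus_0_r.
eapply Rle_lt_trans; [exact Hj|].
replace (L * (eps / (2 * L))) with (eps / 2) by (field; lra).
pose proof (cond_pos eps). lra.
Qed.

(** A quotient of functions vanishing at 0 extends by 0 when the numerator
    vanishes to a higher order.  The value at 0 is the right one because the
    quotient [0 / g 0] is 0 whatever the inverse of 0 is. *)
Lemma continuity_pt_quotient_at_zero (f g : R -> R) (l : R) :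
  f 0 = 0 -> g 0 = 0 -> l <> 0 ->
  is_derive f 0 0 -> is_derive g 0 l ->
  continuity_pt (fun x => f x / g x) 0.
Proof.
intros Hf0 Hg0 Hl Hf Hg.
apply is_derive_Reals in Hf. apply is_derive_Reals in Hg.
assert (Hl2 : 0 < Rabs l / 2) by (pose proof (Rabs_pos_lt l Hl); lra).
intros eps Heps.
destruct (Hf (eps * (Rabs l / 2))) as [d1 Hd1]; [nra|].
destruct (Hg (Rabs l / 2) Hl2) as [d2 Hd2].
exists (Rmin d1 d2). split; [apply Rmin_pos; apply cond_pos|].
intros x [[_ Hx0] Hx]. simpl in *. unfold R_dist in *.
rewrite Rminus_0_r in Hx.
assert (Hx1 : Rabs x < d1) by (eapply Rlt_le_trans; [exact Hx | apply Rmin_l]).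
assert (Hx2 : Rabs x < d2) by (eapply Rlt_le_trans; [exact Hx | apply Rmin_r]).
specialize (Hd1 x (not_eq_sym Hx0) Hx1). specialize (Hd2 x (not_eq_sym Hx0) Hx2).
rewrite Rplus_0_l, Hf0, !Rminus_0_r in Hd1.
rewrite Rplus_0_l, Hg0, Rminus_0_r in Hd2.
assert (Hxp : 0 < Rabs x) by (apply Rabs_pos_lt; auto).
assert (Hgx : Rabs l / 2 < Rabs (g x / x)).
{ pose proof (Rabs_triang_inv l (l - g x / x)).
  replace (l - (l - g x / x)) with (g x / x) in H by ring.
  rewrite Rabs_minus_sym in Hd2. lra. }
rewrite Hf0. replace (0 / g 0) with 0 by (unfold Rdiv; ring). rewrite Rminus_0_r.
assert (Hgx0 : g x <> 0).
{ intro E. rewrite E in Hgx. unfold Rdiv in Hgx at 2.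
  rewrite Rmult_0_l, Rabs_R0 in Hgx. lra. }
replace (f x / g x) with ((f x / x) / (g x / x)) by (field; auto).
unfold Rdiv at 1. rewrite Rabs_mult, Rabs_inv.
apply Rmult_lt_reg_r with (Rabs (g x / x)); [lra|].
rewrite Rmult_assoc, Rinv_l by lra. nra.
Qed.

(** * The character modulo 3 *)

Definition chi (n : nat) : R := IZR (legendre3 n).

Lemma chi_residue (k r : nat) : (r < 3)%nat -> chi (3 * k + r) = chi r.
Proof.
intros Hr. unfold chi, legendre3.
replace (3 * k + r)%nat with (r + k * 3)%nat by lia.
rewrite Nat.Div0.mod_add. reflexivity.
Qed.

Lemma residue3 (n : nat) : exists k r, (n = 3 * k + r)%nat /\ (r < 3)%nat.
Proof.
exists (n / 3)%nat, (n mod 3)%nat. split.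
- apply Nat.div_mod_eq.
- apply Nat.mod_upper_bound. lia.
Qed.

Lemma chi_neq_0_pos (n : nat) : chi n <> 0 -> (1 <= n)%nat.
Proof. destruct n; [|lia]. intros H. exfalso. apply H. reflexivity. Qed.

Lemma sum_chi_bounds (N : nat) : 0 <= sum_f_R0 chi N <= 1.
Proof.
assert (H : forall k, sum_f_R0 chi (3 * k) = 0 /\ sum_f_R0 chi (3 * k + 1) = 1
                      /\ sum_f_R0 chi (3 * k + 2) = 0).
{ assert (Hstep : forall k, sum_f_R0 chi (3 * k) = 0 ->
     sum_f_R0 chi (3 * k + 1) = 1 /\ sum_f_R0 chi (3 * k + 2) = 0).
  { intros k Hk.
    assert (H1 : sum_f_R0 chi (3 * k + 1) = 1).
    { replace (3 * k + 1)%nat with (S (3 * k)) by lia.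
      rewrite tech5, Hk. replace (S (3 * k)) with (3 * k + 1)%nat by lia.
      rewrite chi_residue by lia. change (chi 1) with 1. ring. }
    split; [exact H1|].
    replace (3 * k + 2)%nat with (S (3 * k + 1)) by lia.
    rewrite tech5, H1. replace (S (3 * k + 1)) with (3 * k + 2)%nat by lia.
    rewrite chi_residue by lia. change (chi 2) with (-1). ring. }
  induction k as [|k [_ [_ IH]]].
  - split; [reflexivity|]. apply Hstep. reflexivity.
  - assert (H0 : sum_f_R0 chi (3 * S k) = 0).
    { replace (3 * S k)%nat with (S (3 * k + 2)) by lia.
      rewrite tech5, IH. replace (S (3 * k + 2)) with (3 * S k + 0)%nat by lia.
      rewrite chi_residue by lia. change (chi 0) with 0. ring. }
    split; [exact H0|]. apply Hstep. exact H0. }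
destruct (residue3 N) as [k [r [-> Hr]]]. destruct (H k) as [H0 [H1 H2]].
destruct r as [|[|[|]]]; try lia.
- rewrite Nat.add_0_r. lra.
- lra.
- lra.
Qed.

Lemma cos_third_turn : cos (2 * PI / 3) = - (1 / 2).
Proof.
replace (2 * PI / 3) with (2 * (PI / 3)) by field. rewrite cos_2PI3. field.
Qed.
Lemma cos_third_turn_multiple (n : nat) : chi n <> 0 ->
  cos (INR n * (2 * PI / 3)) = - (1 / 2).
Proof.
intros Hn. destruct (residue3 n) as [k [r [-> Hr]]].
rewrite chi_residue in Hn by assumption.
pose proof cos_third_turn as H1.
rewrite plus_INR, mult_INR. change (INR 3) with (INR 2 + 1). change (INR 2) with (1 + 1).
destruct r as [|[|[|]]]; try lia.
- exfalso. apply Hn. reflexivity.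
- replace (((1 + 1 + 1) * INR k + INR 1) * (2 * PI / 3))
    with (2 * PI / 3 + 2 * INR k * PI) by (simpl; field).
  rewrite cos_period. exact H1.
- replace (((1 + 1 + 1) * INR k + INR 2) * (2 * PI / 3))
    with (2 * (2 * PI / 3) + 2 * INR k * PI) by (simpl; field).
  rewrite cos_period, cos_2a_cos, H1. field.
Qed.

(** The Dirichlet kernel of the character.  Multiplying by [1 + 2 cos u] makes
    each pair of terms telescope:
    [(1 + 2 cos u) (sin (a + u) - sin (a + 2 u)) = sin a - sin (a + 3 u)]. *)
Lemma sum_chi_sin (K : nat) (u : R) :
  sum_f_R0 (fun n => chi n * sin (INR n * u)) (3 * K) * (1 + 2 * cos u)
  = - sin (3 * INR K * u).
Proof.
induction K as [|K IH].
- simpl. change (chi 0) with 0. rewrite !Rmult_0_l, Rmult_0_r, Rmult_0_l, sin_0. ring.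
- replace (3 * S K)%nat with (S (S (S (3 * K)))) by lia.
  rewrite !tech5, !Rmult_plus_distr_r, IH.
  replace (S (S (S (3 * K)))) with (3 * S K + 0)%nat by lia.
  replace (S (S (3 * K))) with (3 * K + 2)%nat by lia.
  replace (S (3 * K)) with (3 * K + 1)%nat by lia.
  rewrite !chi_residue by lia.
  change (chi 0) with 0. change (chi 1) with 1. change (chi 2) with (-1).
  rewrite !plus_INR, !mult_INR, (S_INR K). change (INR 1) with 1. change (INR 0) with 0.
  replace (INR 2) with 2 by (simpl; ring). replace (INR 3) with 3 by (simpl; ring).
  set (a := 3 * INR K * u).
  replace ((3 * INR K + 1) * u) with (a + u) by (unfold a; ring).
  replace ((3 * INR K + 2) * u) with ((a + u) + u) by (unfold a; ring).
  replace ((3 * (INR K + 1) + 0) * u) with (((a + u) + u) + u) by (unfold a; ring).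
  replace (3 * (INR K + 1) * u) with (((a + u) + u) + u) by (unfold a; ring).
  set (b := a + u).
  rewrite (sin_plus (b + u) u), (sin_plus b u), (cos_plus b u).
  replace a with (b - u) by (unfold b; ring). rewrite sin_minus.
  pose proof (sin2_cos2 u) as H. unfold Rsqr in H.
  assert (Hs : sin u * sin u = 1 - cos u * cos u) by lra.
  ring_simplify. replace (sin u ^ 2) with (1 - cos u * cos u) by (rewrite <- Hs; ring).
  ring.
Qed.

(** * Partial fractions through an integral kernel *)

(** Treats together [cos (x v)], for [s = x^2], and [cosh (t v)], for
    [s = - t^2]. *)
Definition oscillator (s : R) (C C' : R -> R) : Prop :=
  C 0 = 1 /\ C' 0 = 0 /\
  (forall v : R, is_derive C v (C' v)) /\ (forall v : R, is_derive C' v (- s * C v)).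

Lemma oscillator_cos (x : R) : oscillator (x ^ 2) (fun v => cos (x * v)) (fun v => - x * sin (x * v)).
Proof.
split; [|split; [|split]].
- rewrite Rmult_0_r. apply cos_0.
- rewrite Rmult_0_r, sin_0. ring.
- intros v. auto_derive; [exact I|]. ring.
- intros v. auto_derive; [exact I|]. ring.
Qed.

Lemma is_derive_cosh (x : R) : is_derive cosh x (sinh x).
Proof. apply is_derive_Reals, derivable_pt_lim_cosh. Qed.

Lemma is_derive_sinh (x : R) : is_derive sinh x (cosh x).
Proof. apply is_derive_Reals, derivable_pt_lim_sinh. Qed.

Lemma is_derive_scale_arg (f : R -> R) (t v l : R) :
  is_derive f (t * v) l -> is_derive (fun y => f (t * y)) v (t * l).
Proof.
intros H. apply (is_derive_comp f (fun y => t * y)); [exact H|].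
auto_derive; [exact I|]. ring.
Qed.

Lemma oscillator_cosh (t : R) : oscillator (- t ^ 2) (fun v => cosh (t * v)) (fun v => t * sinh (t * v)).
Proof.
split; [|split; [|split]].
- rewrite Rmult_0_r. apply cosh_0.
- rewrite Rmult_0_r, sinh_0. ring.
- intros v. apply is_derive_scale_arg, is_derive_cosh.
- intros v. replace (- - t ^ 2 * cosh (t * v)) with (t * (t * cosh (t * v))) by ring.
  apply (is_derive_scal (fun y => sinh (t * y))).
  apply is_derive_scale_arg, is_derive_sinh.
Qed.

Lemma oscillator_continuous (s : R) (C C' : R -> R) (v : R) :
  oscillator s C C' -> continuous C v.
Proof.
intros (_ & _ & HC & _). apply (ex_derive_continuous C). exists (C' v). apply HC.
Qed.

(** Two integrations by parts.  As [C(0) = 1] and [C'(0) = 0], the boundary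
    terms amount to [n (C(L) - cos (n L))] with [L = 2 PI / 3]; the length [L] is
    chosen so that [cos (n L) = -1/2] for all [n] prime to 3, which leaves a
    factor [1/2 + C(L)] free of [n]. *)
Lemma is_RInt_sin_oscillator (s : R) (C C' : R -> R) (n : nat) :
  oscillator s C C' -> chi n <> 0 -> INR n ^ 2 <> s ->
  is_RInt (fun v => sin (INR n * (2 * PI / 3 - v)) * C v) 0 (2 * PI / 3)
    ((1 / 2 + C (2 * PI / 3)) * (INR n / (INR n ^ 2 - s))).
Proof.
intros HO Hn Hs. pose proof HO as (HC0 & HC'0 & HC & HC').
set (L := 2 * PI / 3). set (a := INR n).
assert (Has : a ^ 2 - s <> 0) by (unfold a; lra).
set (P := fun v => (a * C v * cos (a * (L - v)) + C' v * sin (a * (L - v))) / (a ^ 2 - s)).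
replace ((1 / 2 + C L) * (a / (a ^ 2 - s))) with (minus (P L) (P 0)).
- apply (is_RInt_derive P).
  + intros v _. unfold P. auto_derive.
    * repeat split; [exists (C' v); apply HC | exists (- s * C v); apply HC'].
    * rewrite (is_derive_unique (fun x : R => C x) _ _ (HC v)).
      rewrite (is_derive_unique (fun x : R => C' x) _ _ (HC' v)).
      change (L - v) with (L + - v). field. nra.
  + intros v _. apply (continuous_mult (K := R_AbsRing) (fun v => sin (a * (L - v))) C).
    * apply (ex_derive_continuous (fun v => sin (a * (L - v)))). auto_derive. exact I.
    * apply (oscillator_continuous s C C' v HO).
- unfold minus, plus, opp, P; simpl. rewrite Rminus_diag, Rmult_0_r, cos_0, sin_0.
  rewrite HC0, HC'0, Rminus_0_r. unfold a, L. rewrite (cos_third_turn_multiple n Hn).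
  fold a L. field. nra.
Qed.

Lemma is_RInt_chi_sum (f : nat -> R -> R) (J : nat -> R) (C : R -> R) (a b : R) (N : nat) :
  (forall n, chi n <> 0 -> is_RInt (fun v => f n v * C v) a b (J n)) ->
  is_RInt (fun v => sum_f_R0 (fun n => chi n * f n v) N * C v) a b
    (sum_f_R0 (fun n => chi n * J n) N).
Proof.
intros H.
assert (H' : forall n, is_RInt (fun v => chi n * f n v * C v) a b (chi n * J n)).
{ intros n. destruct (Req_dec (chi n) 0) as [E|E].
  - rewrite E. apply (is_RInt_ext (fun _ => 0)).
    + intros x _. simpl. ring.
    + replace (0 * J n) with (scal (b - a) 0) by (unfold scal; simpl; unfold mult; simpl; ring).
      apply (is_RInt_const (V := R_NormedModule)).
  - apply (is_RInt_ext (fun v => scal (chi n) (f n v * C v))).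
    + intros x _. unfold scal; simpl; unfold mult; simpl. ring.
    + apply (is_RInt_scal (V := R_NormedModule)). apply H, E. }
induction N as [|N IH]; [apply H'|].
rewrite tech5.
apply (is_RInt_ext (fun v => plus (sum_f_R0 (fun n => chi n * f n v) N * C v)
                                  (chi (S N) * f (S N) v * C v))).
- intros x _. rewrite tech5. unfold plus; simpl. ring.
- apply (is_RInt_plus (V := R_NormedModule)); [exact IH | apply H'].
Qed.

Definition chi_resolvent (N : nat) (s : R) : R :=
  sum_f_R0 (fun n => chi n * (INR n / (INR n ^ 2 - s))) N.

Lemma is_RInt_kernel_oscillator (s : R) (C C' : R -> R) (N : nat) :
  oscillator s C C' -> (forall n, (1 <= n)%nat -> INR n ^ 2 <> s) ->
  is_RInt (fun v => sum_f_R0 (fun n => chi n * sin (INR n * (2 * PI / 3 - v))) N * C v)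
    0 (2 * PI / 3) ((1 / 2 + C (2 * PI / 3)) * chi_resolvent N s).
Proof.
intros HO Hs. unfold chi_resolvent. rewrite scal_sum.
rewrite (sum_eq _ (fun n => chi n * ((1 / 2 + C (2 * PI / 3)) * (INR n / (INR n ^ 2 - s)))))
  by (intros; ring).
apply (is_RInt_chi_sum (fun n v => sin (INR n * (2 * PI / 3 - v)))).
intros n Hn. apply (is_RInt_sin_oscillator s C C'); auto.
apply Hs, chi_neq_0_pos, Hn.
Qed.

(** At the resonance [s = 1] all the integrals with [n > 1] vanish, since
    [1/2 + cos (2 PI / 3) = 0]; only [n = 1] contributes, and so the value does
    not depend on [N]. *)
Lemma is_RInt_kernel_cos (N : nat) : (1 <= N)%nat ->
  is_RInt (fun v => sum_f_R0 (fun n => chi n * sin (INR n * (2 * PI / 3 - v))) N * cos v)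
    0 (2 * PI / 3) (PI * sqrt 3 / 6).
Proof.
intros HN.
set (J := fun n => if Nat.eqb n 1 then PI * sqrt 3 / 6 else 0).
replace (PI * sqrt 3 / 6) with (sum_f_R0 (fun n => chi n * J n) N).
- apply (is_RInt_chi_sum (fun n v => sin (INR n * (2 * PI / 3 - v)))).
  intros n Hn. unfold J. destruct (Nat.eqb_spec n 1) as [->|Hn1].
  + set (L := 2 * PI / 3). set (P := fun v => v * sin L / 2 + cos (L - 2 * v) / 4).
    replace (PI * sqrt 3 / 6) with (minus (P L) (P 0)).
    * apply (is_RInt_derive P).
      -- intros v _. unfold P. auto_derive; [exact I|]. change (INR 1) with 1.
         replace (L + - (2 * v)) with ((L - v) - v) by ring.
         replace (sin L) with (sin ((L - v) + v)) by (f_equal; ring).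
         set (w := L - v).
         rewrite (sin_plus w v), (sin_minus w v), !Rmult_1_l. field.
      -- intros v _. apply (ex_derive_continuous (fun v => sin (INR 1 * (L - v)) * cos v)).
         auto_derive. exact I.
    * unfold minus, plus, opp, P; simpl. rewrite Rmult_0_r, Rminus_0_r.
      replace (L - 2 * L) with (- L) by ring. rewrite cos_neg.
      unfold L. replace (2 * PI / 3) with (2 * (PI / 3)) by field. rewrite sin_2PI3. field.
  + assert (Hc : oscillator (1 ^ 2) (fun v => cos (1 * v)) (fun v => - 1 * sin (1 * v)))
      by apply (oscillator_cos 1).
    pose proof (chi_neq_0_pos n Hn) as Hpos.
    assert (H2 : 2 <= INR n) by (replace 2 with (INR 2) by (simpl; ring); apply le_INR; lia).
    pose proof (is_RInt_sin_oscillator _ _ _ n Hc Hn ltac:(nra)) as HI. cbv beta in HI.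
    replace (cos (1 * (2 * PI / 3))) with (- (1 / 2)) in HI.
    * replace 0 with ((1 / 2 + - (1 / 2)) * (INR n / (INR n ^ 2 - 1 ^ 2))) at 2 by ring.
      eapply is_RInt_ext; [|exact HI]. intros x _. cbv beta. rewrite Rmult_1_l. reflexivity.
    * rewrite Rmult_1_l. symmetry. apply cos_third_turn.
- induction N as [|N IH]; [lia|]. rewrite tech5.
  destruct N as [|N].
  + simpl. change (chi 0) with 0. change (chi 1) with 1. unfold J; simpl. ring.
  + rewrite IH by lia. change (J (S (S N))) with 0. ring.
Qed.

Lemma kernel_denominator_pos (v : R) : 0 < v <= 2 * PI / 3 -> 0 < 1 + 2 * cos (2 * PI / 3 - v).
Proof.
intros Hv. pose proof PI_RGT_0 as HPI.
assert (H : cos (2 * PI / 3) < cos (2 * PI / 3 - v)) by (apply cos_decreasing_1; lra).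
pose proof cos_third_turn. lra.
Qed.

(** The denominator of the kernel has a simple zero at [v = 0], with slope
    [sqrt 3], whereas [C] and [cos] agree there to first order. *)
Lemma continuity_pt_kernel_quotient (s : R) (C C' : R -> R) (v : R) :
  oscillator s C C' -> 0 <= v <= 2 * PI / 3 ->
  continuity_pt (fun v => (C v - cos v) / (1 + 2 * cos (2 * PI / 3 - v))) v.
Proof.
intros HO Hv. pose proof HO as (HC0 & HC'0 & HC & _).
pose proof cos_third_turn as HcosL.
assert (HsinL : sin (2 * PI / 3) = sqrt 3 / 2).
{ replace (2 * PI / 3) with (2 * (PI / 3)) by field. apply sin_2PI3. }
assert (Hnum : is_derive (fun v => C v - cos v) v (C' v + sin v)).
{ replace (C' v + sin v) with (minus (C' v) (- sin v)) by (unfold minus, plus, opp; simpl; ring).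
  apply (is_derive_minus C cos); [apply HC | apply is_derive_Reals, derivable_pt_lim_cos]. }
assert (Hden : is_derive (fun v => 1 + 2 * cos (2 * PI / 3 - v)) v (2 * sin (2 * PI / 3 - v))).
{ auto_derive; [exact I|]. unfold Rminus. ring. }
destruct (Req_dec v 0) as [->|Hv0].
- apply (continuity_pt_quotient_at_zero (fun v => C v - cos v)
           (fun v => 1 + 2 * cos (2 * PI / 3 - v)) (sqrt 3)).
  + rewrite HC0, cos_0. ring.
  + rewrite Rminus_0_r, HcosL. field.
  + pose proof (sqrt_lt_R0 3). lra.
  + rewrite HC'0, sin_0, Rplus_0_r in Hnum. exact Hnum.
  + rewrite Rminus_0_r, HsinL in Hden. replace (sqrt 3) with (2 * (sqrt 3 / 2)) by field.
    exact Hden.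
- apply (continuity_pt_div (fun v => C v - cos v) (fun v => 1 + 2 * cos (2 * PI / 3 - v))).
  + apply derivable_continuous_pt. eexists. apply is_derive_Reals. exact Hnum.
  + apply derivable_continuous_pt. eexists. apply is_derive_Reals. exact Hden.
  + apply Rgt_not_eq, kernel_denominator_pos. lra.
Qed.

(** With [x^2 = s], [x] imaginary when [s < 0], this is the pole expansion of
    [(PI / sqrt 3) / (1 + 2 cos (2 PI x / 3))].  The kernel has a closed form
    only at the multiples of 3; [chi_sum_error] gives the other ranks. *)
Lemma chi_resolvent_lim (s : R) (C C' : R -> R) :
  oscillator s C C' -> (forall n, (1 <= n)%nat -> INR n ^ 2 <> s) ->
  1 / 2 + C (2 * PI / 3) <> 0 ->
  is_lim_seq (fun K => chi_resolvent (3 * K) s) (PI * sqrt 3 / 6 / (1 / 2 + C (2 * PI / 3))).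
Proof.
intros HO Hs HC.
set (L := 2 * PI / 3) in *. set (c := PI * sqrt 3 / 6).
assert (HL : 0 < L) by (unfold L; pose proof PI_RGT_0; lra).
set (g := fun v => (C v - cos v) / (1 + 2 * cos (L - v))).
pose proof (riemann_lebesgue_periods g L HL
  (fun v Hv => continuity_pt_kernel_quotient s C C' v HO Hv)) as HRL.
assert (Hlim : is_lim_seq
  (fun K => (RInt (fun v => sin (2 * PI * INR K / L * v) * g v) 0 L + c) / (1 / 2 + C L))
  ((0 + c) / (1 / 2 + C L))).
{ unfold Rdiv at 1 5. apply is_lim_seq_mult'; [|apply is_lim_seq_const].
  apply is_lim_seq_plus'; [exact HRL | apply is_lim_seq_const]. }
rewrite Rplus_0_l in Hlim.
eapply is_lim_seq_ext_loc; [|exact Hlim].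
exists 1%nat. intros K HK.
set (D := fun v => sum_f_R0 (fun n => chi n * sin (INR n * (L - v))) (3 * K)).
assert (HI : is_RInt (fun v => sin (2 * PI * INR K / L * v) * g v) 0 L
               ((1 / 2 + C L) * chi_resolvent (3 * K) s - c)).
{ apply (is_RInt_ext (fun v => minus (D v * C v) (D v * cos v))).
  - intros v Hv. rewrite Rmin_left, Rmax_right in Hv by lra.
    assert (Hden : 0 < 1 + 2 * cos (L - v)) by (apply kernel_denominator_pos; fold L; lra).
    pose proof (sum_chi_sin K (L - v)) as HD. change (D v * (1 + 2 * cos (L - v)) =
      - sin (3 * INR K * (L - v))) in HD.
    (* [3 K L] is a whole number of turns. *)
    replace (3 * INR K * (L - v)) with (- (3 * INR K * v) + 2 * INR K * PI) in HD
      by (unfold L; field).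
    rewrite sin_period, sin_neg, Ropp_involutive in HD.
    replace (2 * PI * INR K / L * v) with (3 * INR K * v)
      by (unfold L; field; apply Rgt_not_eq, PI_RGT_0).
    rewrite <- HD. unfold g, minus, plus, opp; simpl. field. lra.
  - apply (is_RInt_minus (V := R_NormedModule)).
    + apply (is_RInt_kernel_oscillator s C C'); assumption.
    + apply is_RInt_kernel_cos. lia. }
rewrite (is_RInt_unique _ _ _ _ HI). field. lra.
Qed.

(** Leibniz's test for the character.  The partial sums [X] of [chi] are 0 or 1,
    so by Abel summation the intervals
    [[T n - X n * b (n+1), T n - X n * b (n+1) + b (n+1)]] are nested; each
    contains the [n]-th partial sum [T n], hence all later ones and the
    limit. *)
Lemma chi_sum_error (b : nat -> R) (l : R) (N : nat) :
  (forall n, (N < n)%nat -> 0 <= b (S n) <= b n) ->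
  is_lim_seq (fun K => sum_f_R0 (fun n => chi n * b n) (3 * K)) l ->
  Rabs (sum_f_R0 (fun n => chi n * b n) N - l) <= b (S N).
Proof.
intros Hb Hl.
set (T := sum_f_R0 (fun n => chi n * b n)) in *. set (X := sum_f_R0 chi).
set (U := fun n => T n - X n * b (S n)).
assert (HX : forall n, 0 <= X n <= 1) by apply sum_chi_bounds.
assert (Hnest : forall k, U N <= U (N + k)%nat /\ U (N + k)%nat + b (S (N + k)) <= U N + b (S N)).
{ induction k as [|k [IH1 IH2]]; [rewrite Nat.add_0_r; lra|].
  rewrite Nat.add_succ_r. set (m := (N + k)%nat) in *.
  assert (Hm : 0 <= b (S (S m)) <= b (S m)) by (apply Hb; lia).
  assert (HU : U (S m) = U m + X (S m) * (b (S m) - b (S (S m)))).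
  { unfold U, T, X. rewrite !tech5. ring. }
  pose proof (HX (S m)). nra. }
assert (HT : forall k, U N <= T (N + k)%nat <= U N + b (S N)).
{ intros k. destruct (Hnest k) as [H1 H2].
  assert (H0 : 0 <= b (S (N + k))).
  { destruct k as [|k].
    - rewrite Nat.add_0_r in *.
      destruct (Hb (S N) ltac:(lia)) as [Ha Hc]. lra.
    - apply (Hb (N + S k)%nat). lia. }
  unfold U in H1, H2 at 1. pose proof (HX (N + k)%nat).
  unfold U in *. nra. }
assert (Hev : forall K, (N <= K)%nat -> U N <= T (3 * K)%nat <= U N + b (S N)).
{ intros K HK. replace (3 * K)%nat with (N + (3 * K - N))%nat by lia. apply HT. }
assert (Hl1 : U N <= l).
{ apply (is_lim_seq_le_loc (fun _ => U N) (fun K => T (3 * K)%nat) (U N) l);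
    [exists N; intros; apply Hev; assumption | apply is_lim_seq_const | exact Hl]. }
assert (Hl2 : l <= U N + b (S N)).
{ apply (is_lim_seq_le_loc (fun K => T (3 * K)%nat) (fun _ => U N + b (S N)) l (U N + b (S N)));
    [exists N; intros; apply Hev; assumption | exact Hl | apply is_lim_seq_const]. }
specialize (HT 0%nat). rewrite Nat.add_0_r in HT.
apply Rabs_le. lra.
Qed.

(** The bound involves [s] only through the range it lies in: this uniformity is
    what allows the limit to be taken under the mean value theorem.  The lower
    bound on [N] makes [n / (n^2 - s)] decreasing for [n > N]. *)
Lemma chi_resolvent_error (A s : R) (C C' : R -> R) (N : nat) :
  oscillator s C C' -> (forall n, (1 <= n)%nat -> INR n ^ 2 <> s) ->
  1 / 2 + C (2 * PI / 3) <> 0 ->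
  - A <= s <= 9 / 4 -> (2 <= N)%nat -> A <= INR N ->
  Rabs (chi_resolvent N s - PI * sqrt 3 / 6 / (1 / 2 + C (2 * PI / 3))) <= 2 / INR (S N).
Proof.
intros HO Hs HC HA HN HAN.
assert (HN2 : 2 <= INR N) by (replace 2 with (INR 2) by (simpl; ring); apply le_INR; lia).
eapply Rle_trans.
- apply (chi_sum_error (fun n => INR n / (INR n ^ 2 - s))).
  + intros n Hn. rewrite S_INR.
    assert (HNn : INR N + 1 <= INR n) by (rewrite <- S_INR; apply le_INR; lia).
    set (x := INR n) in *.
    assert (H1 : 0 < x ^ 2 - s) by nra. assert (H2 : 0 < (x + 1) ^ 2 - s) by nra.
    split; [apply Rlt_le, Rdiv_lt_0_compat; lra|].
    apply Rle_div_l; [lra|].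
    replace (x / (x ^ 2 - s) * ((x + 1) ^ 2 - s)) with (x * ((x + 1) ^ 2 - s) / (x ^ 2 - s))
      by (field; lra).
    apply Rle_div_r; [lra|]. nra.
  + exact (chi_resolvent_lim s C C' HO Hs HC).
- rewrite S_INR. cbv beta. set (x := INR N + 1) in *.
  assert (Hx : 3 <= x) by (unfold x; lra).
  assert (H1 : 0 < x ^ 2 - s) by nra.
  apply Rle_div_l; [lra|].
  replace (2 / x * (x ^ 2 - s)) with (2 * (x ^ 2 - s) / x) by (field; lra).
  apply Rle_div_r; [lra|]. nra.
Qed.

(** * The curve of admissible parameters *)

Lemma cosh_ge_1 (x : R) : 1 <= cosh x.
Proof.
unfold cosh. rewrite exp_Ropp. pose proof (exp_pos x) as H.
replace ((exp x + / exp x) / 2) with (1 + (exp x - 1) ^ 2 / (2 * exp x)) by (field; lra).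
assert (0 <= (exp x - 1) ^ 2 / (2 * exp x)); [|lra].
apply Rle_div_r; [lra|]. rewrite Rmult_0_l. apply pow2_ge_0.
Qed.

Lemma sinh2_cosh2 (x : R) : sinh x ^ 2 = cosh x ^ 2 - 1.
Proof.
unfold cosh, sinh. rewrite exp_Ropp. field. apply Rgt_not_eq, exp_pos.
Qed.

Lemma cosh_double (x : R) : cosh (2 * x) = 2 * cosh x ^ 2 - 1.
Proof.
unfold cosh. replace (- (2 * x)) with (- x + - x) by ring.
replace (2 * x) with (x + x) by ring. rewrite !exp_plus, exp_Ropp.
field. apply Rgt_not_eq, exp_pos.
Qed.

Lemma sqrt3_sqr : sqrt 3 ^ 2 = 3.
Proof. apply pow2_sqrt. lra. Qed.

Definition curve_angle (t : R) : R := atan (tanh (PI * t / 3) / sqrt 3).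

Definition curve (t : R) : R := 3 / 2 - 3 / PI * curve_angle t.

(** The derivative of [curve], written with the quantity
    [1/2 + C(2 PI / 3)] of the hyperbolic expansion. *)
Definition curve_speed (t : R) : R := - (sqrt 3 / 2) / (1 / 2 + cosh (t * (2 * PI / 3))).

Lemma is_derive_tanh (x : R) : is_derive tanh x (/ cosh x ^ 2).
Proof.
pose proof (cosh_ge_1 x).
replace (/ cosh x ^ 2) with ((cosh x * cosh x - sinh x * sinh x) / cosh x ^ 2)
  by (replace (sinh x * sinh x) with (sinh x ^ 2) by ring; rewrite sinh2_cosh2; field; lra).
apply (is_derive_div sinh cosh); [apply is_derive_sinh | apply is_derive_cosh | lra].
Qed.

Lemma half_plus_cosh (t : R) :
  1 / 2 + cosh (t * (2 * PI / 3)) = (4 * cosh (PI * t / 3) ^ 2 - 1) / 2.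
Proof.
replace (t * (2 * PI / 3)) with (2 * (PI * t / 3)) by field. rewrite cosh_double. field.
Qed.

Lemma one_plus_sqr_slope (t : R) :
  1 + (tanh (PI * t / 3) / sqrt 3) ^ 2
  = (4 * cosh (PI * t / 3) ^ 2 - 1) / (3 * cosh (PI * t / 3) ^ 2).
Proof.
pose proof (cosh_ge_1 (PI * t / 3)). pose proof (sqrt_lt_R0 3 ltac:(lra)).
unfold tanh. unfold Rdiv at 1. rewrite !Rpow_mult_distr.
replace ((sinh (PI * t / 3) / cosh (PI * t / 3)) ^ 2)
  with (sinh (PI * t / 3) ^ 2 / cosh (PI * t / 3) ^ 2) by (field; lra).
rewrite sinh2_cosh2, pow_inv, sqrt3_sqr. field. lra.
Qed.

Lemma is_derive_curve (t : R) : is_derive curve t (curve_speed t).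
Proof.
pose proof PI_RGT_0. pose proof (sqrt_lt_R0 3 ltac:(lra)) as Hs.
pose proof (cosh_ge_1 (PI * t / 3)) as Hc.
set (c := cosh (PI * t / 3)) in *.
unfold curve, curve_angle.
auto_derive.
- exists (/ cosh (PI * t * / 3) ^ 2). apply is_derive_tanh.
- rewrite (is_derive_unique (fun x : R => tanh x) _ _ (is_derive_tanh _)).
  change (PI * t * / 3) with (PI * t / 3). fold c.
  change (tanh (PI * t / 3) * / sqrt 3) with (tanh (PI * t / 3) / sqrt 3).
  unfold curve_speed. rewrite half_plus_cosh.
  pose proof (one_plus_sqr_slope t) as H1. fold c in H1 |- *.
  match goal with |- context [/ (1 + ?e)] =>
    replace (1 + e) with ((4 * c ^ 2 - 1) / (3 * c ^ 2))
      by (rewrite <- H1; unfold Rsqr; ring) end.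
  pose proof sqrt3_sqr as H3.
  transitivity (- (3 / sqrt 3) / (4 * c ^ 2 - 1)).
  + field. repeat split; nra.
  + rewrite <- H3 at 1. field. repeat split; nra.
Qed.

(** The two denominators of the partial fraction expansions are inverse to each
    other up to a constant; this and [is_derive_curve] are the only facts on
    the curve that make the derivatives cancel. *)
Lemma half_plus_cos_curve (t : R) :
  1 / 2 + cos (curve t * (2 * PI / 3)) = - (3 / 4) / (1 / 2 + cosh (t * (2 * PI / 3))).
Proof.
pose proof PI_RGT_0. pose proof (cosh_ge_1 (PI * t / 3)) as Hc.
rewrite half_plus_cosh. unfold curve.
replace ((3 / 2 - 3 / PI * curve_angle t) * (2 * PI / 3)) with (- (2 * curve_angle t) + PI)
  by (field; lra).
rewrite neg_cos, cos_neg, cos_2a_cos. unfold curve_angle. rewrite cos_atan.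
pose proof (one_plus_sqr_slope t) as H1.
set (y := tanh (PI * t / 3) / sqrt 3) in *. set (c := cosh (PI * t / 3)) in *.
assert (Hy : 0 < 1 + y ^ 2) by nra.
replace (1 + y²) with (1 + y ^ 2) by (unfold Rsqr; ring).
replace (2 * (1 / sqrt (1 + y ^ 2)) * (1 / sqrt (1 + y ^ 2))) with (2 / (sqrt (1 + y ^ 2) ^ 2))
  by (field; apply Rgt_not_eq, sqrt_lt_R0; exact Hy).
rewrite pow2_sqrt by lra. rewrite H1. field. repeat split; nra.
Qed.

Lemma half_plus_cosh_ge (x : R) : 3 / 2 <= 1 / 2 + cosh x.
Proof. pose proof (cosh_ge_1 x). lra. Qed.

Lemma curve_speed_bound (t : R) : Rabs (curve_speed t) <= 1.
Proof.
unfold curve_speed. pose proof (half_plus_cosh_ge (t * (2 * PI / 3))) as H.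
set (d := 1 / 2 + cosh (t * (2 * PI / 3))) in *.
pose proof (sqrt_lt_R0 3 ltac:(lra)). pose proof sqrt3_sqr.
assert (sqrt 3 <= 2) by nra.
rewrite Rabs_div, Rabs_Ropp, (Rabs_pos_eq d), (Rabs_pos_eq (sqrt 3 / 2)) by lra.
apply Rle_div_l; lra.
Qed.

Lemma curve_0 : curve 0 = 3 / 2.
Proof.
unfold curve, curve_angle, tanh. rewrite Rmult_0_r. unfold Rdiv at 3 4 5.
rewrite Rmult_0_l, sinh_0, !Rmult_0_l, atan_0. ring.
Qed.

Lemma curve_range (t : R) : 0 <= t -> 1 < curve t <= 3 / 2.
Proof.
intros Ht. pose proof PI_RGT_0 as HPI.
pose proof (cosh_ge_1 (PI * t / 3)) as Hc. pose proof (sqrt_lt_R0 3 ltac:(lra)) as Hs.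
assert (Hsinh : 0 <= sinh (PI * t / 3) < cosh (PI * t / 3)).
{ unfold sinh, cosh.
  assert (exp (- (PI * t / 3)) <= exp (PI * t / 3)).
  { destruct (Req_dec t 0) as [->|Ht0].
    - right. f_equal. field.
    - left. apply exp_increasing. nra. }
  pose proof (exp_pos (- (PI * t / 3))). lra. }
assert (HT : 0 <= tanh (PI * t / 3) < 1).
{ unfold tanh. split.
  - apply Rle_div_r; lra.
  - apply Rlt_div_l; lra. }
assert (Hinv : 0 < / sqrt 3) by (apply Rinv_0_lt_compat; exact Hs).
assert (Hang : 0 <= curve_angle t < PI / 6).
{ unfold curve_angle. split.
  - rewrite <- atan_0. destruct (Req_dec (tanh (PI * t / 3)) 0) as [->|HT0].
    + right. f_equal. unfold Rdiv. ring.
    + left. apply atan_increasing. unfold Rdiv. nra.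
  - rewrite <- (atan_tan (PI / 6)) by lra. apply atan_increasing.
    rewrite tan_PI6. unfold Rdiv. nra. }
assert (H : 3 / PI * curve_angle t < 1 / 2).
{ apply Rmult_lt_reg_l with (PI / 3); [lra|].
  replace (PI / 3 * (3 / PI * curve_angle t)) with (curve_angle t) by (field; lra). lra. }
assert (H0 : 0 <= 3 / PI * curve_angle t).
{ apply Rmult_le_pos; [|lra]. apply Rlt_le, Rdiv_lt_0_compat; lra. }
unfold curve. lra.
Qed.

(** With [u = PI / 2 - PI beta / 3] the relation reads
    [tan u = tanh (PI alpha / 3) / sqrt 3], and the range of [beta] puts [u] in
    the range of [atan]. *)
Lemma curve_unique (alpha beta : R) :
  1 < beta < 3 / 2 -> tanh (PI * alpha / 3) * tan (PI * beta / 3) = sqrt 3 ->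
  beta = curve alpha.
Proof.
intros Hb Hrel. pose proof PI_RGT_0 as HPI. pose proof (sqrt_lt_R0 3 ltac:(lra)) as Hs.
set (u := PI / 2 - PI * beta / 3).
assert (Hu : 0 < u < PI / 6).
{ unfold u. split.
  - assert (PI * beta < PI * (3 / 2)) by (apply Rmult_lt_compat_l; lra). lra.
  - assert (PI * 1 < PI * beta) by (apply Rmult_lt_compat_l; lra). lra. }
assert (Hsu : 0 < sin u) by (apply sin_gt_0; lra).
assert (Hcu : 0 < cos u) by (apply cos_gt_0; lra).
assert (Htan : tan (PI * beta / 3) = cos u / sin u).
{ unfold tan. replace (PI * beta / 3) with (PI / 2 - u) by (unfold u; ring).
  rewrite sin_shift, cos_shift. reflexivity. }
assert (Hang : curve_angle alpha = u).
{ unfold curve_angle. rewrite <- (atan_tan u) by lra. f_equal. unfold tan.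
  rewrite Htan in Hrel. rewrite <- Hrel.
  assert (tanh (PI * alpha / 3) <> 0).
  { intro E. rewrite E, Rmult_0_l in Hrel. lra. }
  field. lra. }
unfold curve. rewrite Hang. unfold u. field. lra.
Qed.

(** * Logarithms of the partial products *)

Definition factor (n : nat) (t b : R) : R :=
  (INR n ^ 2 + t ^ 2) * (INR n ^ 2 - b ^ 2) / (INR n ^ 2 * (INR n ^ 2 - 9 / 4)).

Definition log_partial_prod (N : nat) (t : R) : R :=
  sum_f_R0 (fun n => INR n * chi n * ln (factor n t (curve t))) N.

Lemma INR_1_or_ge_2 (n : nat) : (1 <= n)%nat -> INR n = 1 \/ 2 <= INR n.
Proof.
intros Hn. destruct (Nat.eq_dec n 1) as [->|H]; [left; reflexivity|right].
replace 2 with (INR 2) by (simpl; ring). apply le_INR. lia.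
Qed.

Lemma factor_pos (n : nat) (t b : R) : (1 <= n)%nat -> 1 < b <= 3 / 2 -> 0 < factor n t b.
Proof.
intros Hn Hb. unfold factor. pose proof (pow2_ge_0 t).
destruct (INR_1_or_ge_2 n Hn) as [->|H2].
- replace ((1 ^ 2 + t ^ 2) * (1 ^ 2 - b ^ 2) / (1 ^ 2 * (1 ^ 2 - 9 / 4)))
    with ((1 + t ^ 2) * (b ^ 2 - 1) / (5 / 4)) by field.
  apply Rdiv_lt_0_compat; [|lra]. apply Rmult_lt_0_compat; nra.
- apply Rdiv_lt_0_compat; apply Rmult_lt_0_compat; nra.
Qed.

Lemma sqr_INR_neq_sqr (n : nat) (b : R) : (1 <= n)%nat -> 1 < b <= 3 / 2 -> INR n ^ 2 <> b ^ 2.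
Proof.
intros Hn Hb. destruct (INR_1_or_ge_2 n Hn) as [->|H2]; nra.
Qed.

Lemma sqr_INR_neq_opp_sqr (n : nat) (t : R) : (1 <= n)%nat -> INR n ^ 2 <> - t ^ 2.
Proof.
intros Hn. pose proof (pow2_ge_0 t). destruct (INR_1_or_ge_2 n Hn) as [->|H2]; nra.
Qed.

Lemma is_derive_ln_factor (n : nat) (t : R) : (1 <= n)%nat -> 0 <= t ->
  is_derive (fun x => ln (factor n x (curve x))) t
    (2 * t / (INR n ^ 2 - - t ^ 2) - 2 * curve t * curve_speed t / (INR n ^ 2 - curve t ^ 2)).
Proof.
intros Hn Ht. pose proof (curve_range t Ht) as Hb.
pose proof (factor_pos n t _ Hn Hb) as Hpos.
pose proof (sqr_INR_neq_sqr n _ Hn Hb) as H1.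
pose proof (sqr_INR_neq_opp_sqr n t Hn) as H2.
assert (Hn0 : INR n <> 0) by (apply not_0_INR; lia).
assert (H3 : INR n ^ 2 - 9 / 4 <> 0) by (destruct (INR_1_or_ge_2 n Hn) as [->|]; nra).
unfold factor in *.
auto_derive.
- split; [exists (curve_speed t); apply is_derive_curve|].
  split; [exact Hpos | exact I].
- rewrite (is_derive_unique (fun x : R => curve x) _ _ (is_derive_curve t)).
  field. repeat split; nra.
Qed.

Lemma is_derive_log_partial_prod (N : nat) (t : R) : 0 <= t ->
  is_derive (log_partial_prod N) t
    (2 * t * chi_resolvent N (- t ^ 2)
     - 2 * curve t * curve_speed t * chi_resolvent N (curve t ^ 2)).
Proof.
intros Ht. unfold log_partial_prod, chi_resolvent. induction N as [|N IH].
- simpl sum_f_R0. change (chi 0) with 0.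
  apply (is_derive_ext (fun _ => 0)).
  + intros x. simpl. ring.
  + rewrite !Rmult_0_l, !Rmult_0_r, Rminus_0_r. apply (is_derive_const (V := R_NormedModule)).
- rewrite !tech5.
  match goal with |- is_derive _ _ ?d => replace d with (Rplus
    (2 * t * sum_f_R0 (fun n => chi n * (INR n / (INR n ^ 2 - - t ^ 2))) N
      - 2 * curve t * curve_speed t *
          sum_f_R0 (fun n => chi n * (INR n / (INR n ^ 2 - curve t ^ 2))) N)
    (INR (S N) * chi (S N) * (2 * t / (INR (S N) ^ 2 - - t ^ 2)
      - 2 * curve t * curve_speed t / (INR (S N) ^ 2 - curve t ^ 2)))) end.
  + apply (is_derive_plus (V := R_NormedModule)); [exact IH|].
    apply (is_derive_scal (fun x => ln (factor (S N) x (curve x)))).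
    apply is_derive_ln_factor; [lia | exact Ht].
  + unfold Rdiv. ring.
Qed.

Lemma log_partial_prod_0 (N : nat) : log_partial_prod N 0 = 0.
Proof.
unfold log_partial_prod. rewrite curve_0. induction N as [|N IH].
- simpl. change (chi 0) with 0. ring.
- rewrite tech5, IH.
  replace (factor (S N) 0 (3 / 2)) with 1; [rewrite ln_1; ring|].
  unfold factor. field.
  destruct (INR_1_or_ge_2 (S N) ltac:(lia)) as [->|]; split; nra.
Qed.

(** Mean value theorem for the defect [Phi], which vanishes at 0.  In its
    derivative each sum may be replaced by its error: the contributions of the
    limits compensate the derivative of [(2 PI / 3) t * curve t]. *)
Lemma log_partial_prod_bound (alpha : R) (N : nat) :
  0 < alpha -> (2 <= N)%nat -> alpha ^ 2 <= INR N ->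
  Rabs (log_partial_prod N alpha + 2 * PI / 3 * (alpha * curve alpha))
    <= (4 * alpha + 6) * alpha / INR (S N).
Proof.
intros Ha HN HaN.
set (Phi := fun t => log_partial_prod N t + 2 * PI / 3 * (t * curve t)).
set (dPhi := fun t => (2 * t * chi_resolvent N (- t ^ 2)
     - 2 * curve t * curve_speed t * chi_resolvent N (curve t ^ 2))
     + 2 * PI / 3 * (curve t + t * curve_speed t)).
assert (HPhi : forall t, 0 <= t -> is_derive Phi t (dPhi t)).
{ intros t Ht. apply (is_derive_plus (V := R_NormedModule)).
  - apply is_derive_log_partial_prod, Ht.
  - auto_derive; [exists (curve_speed t); apply is_derive_curve|].
    rewrite (is_derive_unique (fun x : R => curve x) _ _ (is_derive_curve t)). field. }
destruct (MVT_gen Phi 0 alpha dPhi) as [t [Ht HMVT]].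
{ intros x Hx. rewrite Rmin_left in Hx by lra. apply HPhi. lra. }
{ intros x Hx. rewrite Rmin_left in Hx by lra.
  apply derivable_continuous_pt. eexists. apply is_derive_Reals. apply HPhi. lra. }
rewrite Rmin_left, Rmax_right in Ht by lra.
assert (HPhi0 : Phi 0 = 0).
{ unfold Phi. rewrite log_partial_prod_0. ring. }
fold (Phi alpha). rewrite HPhi0, Rminus_0_r in HMVT.
rewrite Rminus_0_r in HMVT. rewrite HMVT, Rabs_mult, (Rabs_pos_eq alpha) by lra.
replace ((4 * alpha + 6) * alpha / INR (S N)) with ((4 * alpha + 6) / INR (S N) * alpha)
  by (unfold Rdiv; ring).
apply Rmult_le_compat_r; [lra|].
pose proof (curve_range t (proj1 Ht)) as Hb.
pose proof (half_plus_cosh_ge (t * (2 * PI / 3))) as Hd.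
pose proof (half_plus_cos_curve t) as Hcos.
pose proof PI_RGT_0 as HPI. pose proof (sqrt_lt_R0 3 ltac:(lra)) as Hs3.
assert (Hcos0 : 1 / 2 + cos (curve t * (2 * PI / 3)) <> 0).
{ rewrite Hcos. apply Rlt_not_eq. unfold Rdiv. rewrite Ropp_mult_distr_l_reverse.
  apply Ropp_lt_gt_0_contravar. apply Rmult_lt_0_compat; [lra|]. apply Rinv_0_lt_compat. lra. }
assert (Ht2 : 0 <= t ^ 2 <= alpha ^ 2) by nra.
assert (E1 := chi_resolvent_error (alpha ^ 2) (- t ^ 2) _ _ N (oscillator_cosh t)
  (fun n Hn => sqr_INR_neq_opp_sqr n t Hn) ltac:(lra) ltac:(lra) HN HaN).
assert (E2 := chi_resolvent_error (alpha ^ 2) (curve t ^ 2) _ _ N (oscillator_cos (curve t))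
  (fun n Hn => sqr_INR_neq_sqr n _ Hn Hb) Hcos0 ltac:(nra) HN HaN).
cbv beta in E1, E2. rewrite Hcos in E2.
set (d := 1 / 2 + cosh (t * (2 * PI / 3))) in *.
set (e1 := chi_resolvent N (- t ^ 2) - PI * sqrt 3 / 6 / d) in *.
set (e2 := chi_resolvent N (curve t ^ 2) - PI * sqrt 3 / 6 / (- (3 / 4) / d)) in *.
(* The limits cancel, by the formulas for [curve_speed] and for [cos]. *)
assert (HdPhi : dPhi t = 2 * t * e1 - 2 * curve t * curve_speed t * e2).
{ unfold dPhi, e1, e2, curve_speed. fold d. pose proof sqrt3_sqr as H3.
  apply Rminus_diag_uniq. field_simplify; [|lra..].
  replace (sqrt 3 ^ 2) with 3 by (symmetry; exact H3). field. lra. }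
pose proof (curve_speed_bound t) as Hv.
rewrite HdPhi. unfold Rminus at 1.
eapply Rle_trans; [apply Rabs_triang|]. rewrite Rabs_Ropp, !Rabs_mult.
rewrite (Rabs_pos_eq 2), (Rabs_pos_eq t), (Rabs_pos_eq (curve t)) by lra.
replace ((4 * alpha + 6) / INR (S N))
  with (2 * alpha * (2 / INR (S N)) + 2 * (3 / 2) * 1 * (2 / INR (S N)))
  by (field; apply not_0_INR; lia).
pose proof (Rabs_pos e1). pose proof (Rabs_pos e2). pose proof (Rabs_pos (curve_speed t)).
apply Rplus_le_compat; repeat apply Rmult_le_compat; try lra.
- repeat apply Rmult_le_pos; lra.
Qed.

Lemma log_partial_prod_lim (alpha : R) : 0 < alpha ->
  is_lim_seq (fun N => log_partial_prod N alpha) (- (2 * PI / 3 * (alpha * curve alpha))).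
Proof.
intros Ha. set (l := 2 * PI / 3 * (alpha * curve alpha)).
set (c := (4 * alpha + 6) * alpha).
assert (Hc : is_lim_seq (fun N => c / INR (S N)) 0).
{ replace 0 with (c * 0) by ring. unfold Rdiv.
  apply (is_lim_seq_mult' (fun _ => c) (fun N => / INR (S N)) c 0); [apply is_lim_seq_const|].
  apply (is_lim_seq_incr_1 (fun N => / INR N)).
  apply (is_lim_seq_inv INR p_infty); [apply is_lim_seq_INR | discriminate]. }
assert (H0 : is_lim_seq (fun N => log_partial_prod N alpha + l) 0).
{ apply is_lim_seq_abs_0.
  destruct (INR_unbounded (alpha ^ 2)) as [M HM].
  apply (is_lim_seq_le_le_loc (fun _ => 0) _ (fun N => c / INR (S N)));
    [|apply is_lim_seq_const | exact Hc].
  exists (M + 2)%nat. intros N HN. split; [apply Rabs_pos|].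
  apply log_partial_prod_bound; [exact Ha | lia |].
  assert (INR M <= INR N) by (apply le_INR; lia). lra. }
apply (is_lim_seq_ext (fun N => (log_partial_prod N alpha + l) - l)); [intros; ring|].
replace (- l) with (0 - l) by ring.
apply is_lim_seq_minus'; [exact H0 | apply is_lim_seq_const].
Qed.

Lemma partial_prod_S (a : nat -> R) (N : nat) :
  partial_prod a (S N) = partial_prod a N * a (S N).
Proof.
unfold partial_prod. rewrite seq_S, map_app, fold_right_app. simpl.
rewrite Rmult_1_r.
generalize (map a (seq 1 N)) (a (S N)). intros xs y.
induction xs as [|x xs IH]; simpl; [ring | rewrite IH; ring].
Qed.

Lemma partial_prod_exp (alpha : R) (N : nat) : 0 <= alpha ->
  partial_prod (fun n => powerRZ (factor n alpha (curve alpha)) (Z.of_nat n * legendre3 n)) N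
  = exp (log_partial_prod N alpha).
Proof.
intros Ha. unfold log_partial_prod. induction N as [|N IH].
- simpl. change (chi 0) with 0. rewrite !Rmult_0_l, exp_0. reflexivity.
- rewrite partial_prod_S, IH, tech5, exp_plus. f_equal.
  rewrite powerRZ_Rpower by (apply factor_pos; [lia | apply curve_range, Ha]).
  unfold Rpower. rewrite mult_IZR, <- INR_IZR_INZ. reflexivity.
Qed.

(** * The infinite product *)

Theorem proposition9 (alpha beta : R)
    (Halpha : 0 < alpha)
    (Hbeta : 1 < beta < 3 / 2)
    (Hrel : tanh (PI * alpha / 3) * tan (PI * beta / 3) = sqrt 3) :
  is_infinite_prod
    (fun n : nat =>
       powerRZ
         ((INR n ^ 2 + alpha ^ 2) * (INR n ^ 2 - beta ^ 2)
            / (INR n ^ 2 * (INR n ^ 2 - 9 / 4)))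
         (Z.of_nat n * legendre3 n))
    (exp (- 2 * PI * alpha * beta / 3)).
Proof.
rewrite (curve_unique alpha beta Hbeta Hrel).
unfold is_infinite_prod.
apply (is_lim_seq_ext (fun N => exp (log_partial_prod N alpha))).
{ intros N. symmetry. apply partial_prod_exp. lra. }
replace (- 2 * PI * alpha * curve alpha / 3) with (- (2 * PI / 3 * (alpha * curve alpha)))
  by field.
apply (is_lim_seq_continuous exp).
- apply derivable_continuous_pt, derivable_pt_exp.
- apply log_partial_prod_lim, Halpha.
Qed.
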